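(* For arbitrary integers $e,r\geq 1$, the topological entropy of the Greenberg-Hastings cellular automaton $T$ restricted to the pulse collision subsystem $Z$ is $$h(Z,T|_Z)=2\ln\rho_{e+r},$$ where $\rho_{e+r}$ denotes the largest eigenvalue of the transition matrix $A$, which is the positive real root of $\lambda^{e+r+1}-\lambda^{e+r}-1$. In particular, $h(X,T)\geq 2\ln\rho_{e+r}$.
   Context: Cellular automaton: $\mathcal A=\{0,1,\dots,e+r\}$, $E=\{1,\dots,e\}$. $X=\mathcal A^{\mathbb Z}$ carries the product topology of the discrete topology on $\mathcal A$. For $x\in X$, $(Tx)_k=x_k+1$ if $1\le x_k\le e+r-1$; $(Tx)_k=0$ if $x_k=e+r$; if $x_k=0$, then $(Tx)_k=1$ when $x_{k-1}\in E$ or $x_{k+1}\in E$, and $(Tx)_k=0$ otherwise. Write $x_{[i,j]}$ for the restriction of $x$ to coordinates $i,\dots,j$ (with $i=-\infty$ or $j=\infty$ allowed). $h(\cdot,\cdot)$ denotes topological entropy. Transition matrix $A=(a_{i,j})_{i,j\in\mathcal A}$: $a_{i,j}=1$ if $(i,j)=(0,0)$, or $j=i+1$ with $0\le i\le e+r-1$, or $(i,j)=(e+r,0)$; otherwise $a_{i,j}=0$. Pulse collision subsystem $Z$ (a closed $T$-invariant subset of $X$): let $S_R=\{x\in X: a_{x_i,x_{i-1}}=1\ \forall i\in\mathbb Z\}$, $S_L=\{x\in X: a_{x_i,x_{i+1}}=1\ \forall i\in\mathbb Z\}$. For $p\in\mathbb Z$ let $S_{R,p}^-$ be the set of $x\in\mathcal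 A^{\mathbb Z_{\le p}}$ with $a_{x_i,x_{i-1}}=1$ for all $i\le p$, and $S_{L,p}^+$ the set of $x\in\mathcal A^{\mathbb Z_{\ge p}}$ with $a_{x_i,x_{i+1}}=1$ for all $i\ge p$. Let $S_L^R$ be the set of $x\in X\setminus(S_R\cup S_L)$ for which there is $p\in\mathbb Z$ with $x_{[-\infty,p]}\in S_{R,p}^-$ and $x_{[p+1,\infty]}\in S_{L,p+1}^+$; every such $p$ is called a separating position of $x$, and the set $I_{\mathrm{sp}}(x)$ of them is finite for $x\in S_L^R$. Then $Z$ is the set of $x\in X$ such that either $x\in S_R\cup S_L$, or $x\in S_L^R$ and, with $p=\max I_{\mathrm{sp}}(x)$, we have $x_{p+1}=x_p$ or ($x_{[-\infty,p]}\in S_{R,p}^-$ and $x_{[p,\infty]}\in S_{L,p}^+$). *)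

(* Defs.v *)
From HB Require Import structures.
From mathcomp Require Import all_boot all_order all_algebra.
From mathcomp.real_closed Require Import complex.
From mathcomp Require Import all_classical all_reals all_analysis.
From mathcomp Require Import zify.

Set Implicit Arguments.
Unset Strict Implicit.
Unset Printing Implicit Defensive.
Import Order.TTheory GRing.Theory Num.Theory.
Local Open Scope classical_set_scope.
Local Open Scope ring_scope.

(* Topological entropy in the sense of Adler, Konheim and McAndrew. *)

Definition open_cover (X : topologicalType) (U : set (set X)) : Prop :=
  (forall A, U A -> open A) /\ (forall x, exists2 A, U A & A x).

(* The least number of members of U that cover X (+oo if no finite subfamily
   of U covers X). *)
Definition covering_number (R : realType) (X : Type) (U : set (set X)) : \bar R :=
  ereal_inf [set (n%:R)%:E | n in [set n : nat |
    exists V : 'I_n -> set X,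
      (forall i, U (V i)) /\ (forall x, exists i, V i x)]].

(* U \/ f^-1 U \/ ... \/ f^-(n-1) U, whose members are the intersections
   A_0 `&` f^-1(A_1) `&` ... `&` f^-(n-1)(A_(n-1)) with all A_i in U. *)
Definition iterated_join (X : Type) (f : X -> X) (U : set (set X)) (n : nat) :
    set (set X) :=
  [set \bigcap_(i in `I_n) (iter i f @^-1` A i)
    | A in [set A : nat -> set X | forall i, U (A i)]].

(* The limit of (1/n) ln N(...) exists by subadditivity whenever X is compact
   and f is continuous; it is written as an upper limit to make the definition
   independent of this fact. *)
Definition cover_entropy (R : realType) (X : Type) (f : X -> X)
    (U : set (set X)) : \bar R :=
  limn_esup (fun n : nat =>
    (n%:R^-1)%:E * lne (covering_number R (iterated_join f U n)))%E.

Definition topological_entropy (R : realType) (X : topologicalType)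
    (f : X -> X) : \bar R :=
  ereal_sup [set cover_entropy R f U | U in @open_cover X].

(* The restriction of f to an invariant set K. The type [set_type K] carries
   the subspace topology. *)
Definition restriction (X : Type) (f : X -> X) (K : set X)
    (fK : forall x, K x -> K (f x)) : set_type K -> set_type K :=
  fun x => exist _ (f (set_val x)) (mem_set (fK _ (set_valP x))).
Arguments restriction [X] f K fK.

(* rho is a real eigenvalue and no complex eigenvalue has larger modulus. *)
Definition is_largest_eigenvalue (R : rcfType) (n : nat) (M : 'M[R]_n)
    (rho : R) : Prop :=
  eigenvalue M rho /\
  (forall z : R[i], eigenvalue (map_mx (real_complex R) M) z ->
     `|z| <= rho%:C%C).

Definition cell (e r : nat) : Type := 'I_(e + r).+1.

Definition config (e r : nat) : topologicalType :=
  prod_topology (fun _ : int => discrete_topology (cell e r)).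

Definition excited (e r : nat) (a : cell e r) : bool := (1 <= a <= e)%N.

Definition GH (e r : nat) (x : config e r) : config e r := fun k : int =>
  let a : cell e r := x k in
  if a == 0%N :> nat then
    if excited (x (k - 1)) || excited (x (k + 1)) then inord 1 else ord0
  else if (a < e + r)%N then inord a.+1 else ord0.

Definition transition (e r : nat) (i j : cell e r) : bool :=
  [|| (i == 0%N :> nat) && (j == 0%N :> nat),
      j == i.+1 :> nat
    | (i == (e + r)%N :> nat) && (j == 0%N :> nat)].

Definition transition_mx (R : pzSemiRingType) (e r : nat) :
    'M[R]_((e + r).+1) :=
  \matrix_(i, j) (@transition e r i j)%:R.

Definition S_R (e r : nat) : set (config e r) :=
  [set x | forall i : int, transition (x i) (x (i - 1))].

Definition S_L (e r : nat) : set (config e r) :=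
  [set x | forall i : int, transition (x i) (x (i + 1))].

(* The half-infinite restriction x_[-oo,p] belongs to S_(R,p)^-, expressed on
   the whole configuration x. *)
Definition S_R_minus (e r : nat) (p : int) (x : config e r) : Prop :=
  forall i : int, i <= p -> transition (x i) (x (i - 1)).

(* Likewise, x_[p,+oo] belongs to S_(L,p)^+. *)
Definition S_L_plus (e r : nat) (p : int) (x : config e r) : Prop :=
  forall i : int, p <= i -> transition (x i) (x (i + 1)).

Definition separating_positions (e r : nat) (x : config e r) : set int :=
  [set p | S_R_minus p x /\ S_L_plus (p + 1) x].

Definition S_LR (e r : nat) : set (config e r) :=
  [set x | ~ (S_R x \/ S_L x) /\ separating_positions x !=set0].

Definition is_max (I : set int) (p : int) : Prop :=
  I p /\ (forall q, I q -> q <= p).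

(* For x in S_LR the set of separating positions is finite and nonempty, so
   that the maximal one exists. *)
Definition pulse_collision (e r : nat) : set (config e r) :=
  [set x | S_R x \/ S_L x \/
     (S_LR x /\ exists p : int,
        [/\ is_max (separating_positions x) p &
            x (p + 1) = x p \/ (S_R_minus p x /\ S_L_plus p x)])].

Definition state (e r : nat) (x : config e r) (k : int) : nat :=
  nat_of_ord (x k : cell e r).

Lemma state_le (e r : nat) (x : config e r) (k : int) : (state x k <= e + r)%N.
Proof. by rewrite /state -ltnS; apply: ltn_ord. Qed.

Lemma transitionP (e r : nat) (x : config e r) (i j : int) :
  transition (x i) (x j) <->
  [\/ state x i = 0%N /\ state x j = 0%N, state x j = (state x i).+1
    | state x i = (e + r)%N /\ state x j = 0%N].
Proof.
rewrite /transition -!/(state x _); split.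
- case/or3P => [/andP[/eqP ? /eqP ?]|/eqP ?|/andP[/eqP ? /eqP ?]];
  by [constructor 1|constructor 2|constructor 3].
- by move=> [[-> ->]|->|[-> ->]]; rewrite ?eqxx ?orbT.
Qed.

Lemma state_GH (e r : nat) (e_gt0 : (0 < e)%N) (x : config e r) (k : int) :
  [/\ state x k = 0%N ->
        (1 <= state x (k - 1) <= e)%N \/ (1 <= state x (k + 1) <= e)%N ->
        state (GH x) k = 1%N,
      state x k = 0%N ->
        ~ (1 <= state x (k - 1) <= e)%N -> ~ (1 <= state x (k + 1) <= e)%N ->
        state (GH x) k = 0%N,
      (0 < state x k < e + r)%N -> state (GH x) k = (state x k).+1
    & (0 < state x k)%N -> state x k = (e + r)%N -> state (GH x) k = 0%N].
Proof.
have -> : state (GH x) k = nat_of_ord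
    (if state x k == 0%N then
       if (1 <= state x (k - 1) <= e)%N || (1 <= state x (k + 1) <= e)%N
       then inord 1 else ord0
     else if (state x k < e + r)%N then inord (state x k).+1 else ord0
     : cell e r) by [].
have i1 : nat_of_ord (inord 1 : cell e r) = 1%N by rewrite inordK //; lia.
split.
- by move=> -> /= /orP ->.
- by move=> -> /= /negP/negbTE -> /negP/negbTE ->.
- move=> /andP[h1 h2]; rewrite h2 eqn0Ngt h1 /= inordK //; lia.
- by move=> h1 h2; rewrite eqn0Ngt h1 h2 ltnn.
Qed.

Lemma state_inj (e r : nat) (x : config e r) (i j : int) :
  state x i = state x j -> x i = x j.
Proof. by move=> h; apply: val_inj. Qed.

Lemma GH_shiftR (e r : nat) (e_gt0 : (0 < e)%N) (r_gt0 : (0 < r)%N)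
    (x : config e r) (k : int) :
  transition (x k) (x (k - 1)) ->
  transition (x (k + 1)) (x k) -> state (GH x) k = state x (k - 1).
Proof.
move=> /transitionP h1 /transitionP h2; have [g1 g2 g3 g4] := state_GH e_gt0 x k.
have := state_le x (k - 1); have := state_le x (k + 1); have := state_le x k.
by case: h1 => h1; case: h2 => h2; lia.
Qed.

Lemma GH_shiftL (e r : nat) (e_gt0 : (0 < e)%N) (r_gt0 : (0 < r)%N)
    (x : config e r) (k : int) :
  transition (x k) (x (k + 1)) ->
  transition (x (k - 1)) (x k) -> state (GH x) k = state x (k + 1).
Proof.
move=> /transitionP h1 /transitionP h2; have [g1 g2 g3 g4] := state_GH e_gt0 x k.
have := state_le x (k - 1); have := state_le x (k + 1); have := state_le x k.
by case: h1 => h1; case: h2 => h2; lia.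
Qed.

Lemma GH_pos (e r : nat) (e_gt0 : (0 < e)%N) (x : config e r) (k j : int) :
  (0 < state x k)%N -> transition (x k) (x j) -> state (GH x) k = state x j.
Proof.
move=> h /transitionP t; have [_ _ g3 g4] := state_GH e_gt0 x k.
have := state_le x j; have := state_le x k.
by case: t => t; lia.
Qed.

Lemma eq_transition (e r : nat) (x y : config e r) (i j i' j' : int) :
  state x i = state y i' -> state x j = state y j' ->
  transition (y i') (y j') -> transition (x i) (x j).
Proof. by move=> h1 h2 /transitionP h; apply/transitionP; rewrite h1 h2. Qed.

Lemma pulse_collisionI (e r : nat) (x : config e r) (q : int) :
  separating_positions x q ->
  state x q = state x (q + 1) \/ transition (x q) (x (q + 1)) ->
  pulse_collision x.
Proof.
move=> sq hq.
have [[?|?]|nRL] := pselect (S_R x \/ S_L x); [by left|by right; left|].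
have [b hb] : exists b, forall p, separating_positions x p -> p < b.
  have /existsNP[i hi] : ~ S_R x by move=> h; apply: nRL; left.
  exists i => p [hp _]; rewrite ltNge; apply/negP => ip; apply: hi; exact: hp.
have [p [sp mp] qp] : exists2 p, is_max (separating_positions x) p & q <= p.
  have : exists n : nat, b <= q + n%:Z by exists `|b - q|%N; lia.
  move=> [n]; elim: n q sq {hq} => [|n IH] q sq bn.
    by have := hb _ sq; lia.
  have [[q' sq' qq']|nq] := pselect (exists2 q', separating_positions x q' & q < q').
    have [|p ? ?] := IH q' sq'; first lia.
    by exists p => //; lia.
  exists q => //; split=> // q' sq'; rewrite leNgt; apply/negP => ?.
  by apply: nq; exists q'.
right; right; split; first by split => //; exists q.
exists p; split; first by split.
have [/eqP epq|pq] := boolP (p == q).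
  subst p; case: hq => h; first by left; apply: state_inj.
  right; split; first exact: sp.1.
  move=> i qi; have [/eqP ->//|ne] := boolP (i == q).
  by apply: sp.2; lia.
right; split; first exact: sp.1.
by move=> i pi; apply: sq.2; lia.
Qed.

Lemma pulse_collision_invariant (e r : nat)
    (e_gt0 : (0 < e)%N) (r_gt0 : (0 < r)%N) (x : config e r) :
  pulse_collision x -> pulse_collision (GH x).
Proof.
move=> [xR|[xL|[[nRL _] [p [[[sR sL] mp] cp]]]]].
- have h k : state (GH x) k = state x (k - 1).
    by apply: (GH_shiftR e_gt0 r_gt0) => //; have := xR (k + 1); rewrite addrK.
  by left => i; apply: (eq_transition (h _) (h _)); apply: xR.
- have h k : state (GH x) k = state x (k + 1).
    by apply: (GH_shiftL e_gt0 r_gt0) => //; have := xL (k - 1); rewrite subrK.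
  by right; left => i; apply: (eq_transition (h _) (h _)); apply: xL.
have n00 : ~ (state x p = 0%N /\ state x (p + 1) = 0%N).
  move=> [h0 h1]; have : p + 1 <= p; last by lia.
  apply: mp; split => i hi; last by apply: sL; lia.
  have [/eqP ->|ne] := boolP (i == p + 1); last by apply: sR; lia.
  by rewrite addrK; apply/transitionP; constructor 1.
have hl k : k < p -> state (GH x) k = state x (k - 1).
  move=> kp; apply: (GH_shiftR e_gt0 r_gt0); first by apply: sR; lia.
  by have := sR (k + 1); rewrite addrK; apply; lia.
have hr k : p + 1 < k -> state (GH x) k = state x (k + 1).
  move=> kp; apply: (GH_shiftL e_gt0 r_gt0); first by apply: sL; lia.
  by have := sL (k - 1); rewrite subrK; apply; lia.
have HL q : (forall k, k <= q -> state (GH x) k = state x (k - 1)) -> q <= p ->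
    S_R_minus q (GH x).
  move=> h qp i iq; apply: (eq_transition (h _ _) (h _ _)) => //; first lia.
  by apply: sR; lia.
have HR q : (forall k, q <= k -> state (GH x) k = state x (k + 1)) -> p <= q ->
    S_L_plus q (GH x).
  move=> h qp i iq; apply: (eq_transition (h _ _) (h _ _)) => //; first lia.
  by apply: sL; lia.
case: cp => [cp|[_ sLp]].
  have {}cp : state x (p + 1) = state x p by rewrite /state cp.
  have p0 : (0 < state x p)%N by rewrite lt0n; apply/eqP => h; apply: n00; lia.
  have El : state (GH x) p = state x (p - 1) by apply: GH_pos => //; exact: sR.
  apply: (@pulse_collisionI _ _ _ p).
    split.
    - apply: HL => // k kp; have [/eqP -> //|?] := boolP (k == p).
      by apply: hl; lia.
    - apply: HR; last lia.
      move=> k kp; have [/eqP ->|?] := boolP (k == p + 1); last by apply: hr; lia.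
      by apply: GH_pos; rewrite ?cp //; exact: sL.
  left; have [_ _ c1 d1] := state_GH e_gt0 x p.
  have [_ _ c2 d2] := state_GH e_gt0 x (p + 1).
  have := state_le x p => ple; rewrite cp in c2 d2.
  have [h|h] := ltnP (state x p) (e + r).
    by rewrite c1 ?c2 ?p0.
  by rewrite d1 ?d2 //; apply/eqP; rewrite eqn_leq ple.
have n01 : state x p = 0%N -> state x (p + 1) = 1%N.
  by move=> h; have /transitionP := sLp p (lexx _); case=> t; lia.
have G1 : state x p = 0%N -> state (GH x) p = 1%N.
  move=> h; have [a1 _ _ _] := state_GH e_gt0 x p.
  by apply: a1 => //; right; rewrite n01.
have hr' k : p <= k -> state (GH x) k = state x (k + 1).
  move=> kp; have [/eqP ->|?] := boolP (k == p); last first.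
    apply: (GH_shiftL e_gt0 r_gt0); first by apply: sLp.
    by have := sLp (k - 1); rewrite subrK; apply; lia.
  have [h|h] := posnP (state x p); first by rewrite G1 // n01.
  by apply: GH_pos => //; exact: sLp.
have R0 := HR _ hr' (lexx _).
have /transitionP tl := sR p (lexx _).
have [hc|hc] := pselect (state x p = 0%N /\ state x (p - 1) = 0%N).
- have g1 : state (GH x) (p - 1) = state x (p - 1 - 1) by apply: hl; lia.
  have g2 := G1 hc.1.
  have /transitionP t2 : transition (x (p - 1)) (x (p - 1 - 1)) by apply: sR; lia.
  apply: (@pulse_collisionI _ _ _ (p - 1)); rewrite /separating_positions /= subrK.
    by split=> //; apply: HL => [k kp|]; [apply: hl|]; lia.
  case: t2 => t2.
  + by right; apply/transitionP; constructor 2; lia.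
  + by left; lia.
  + by lia.
- apply: (@pulse_collisionI _ _ _ p); last by right; apply: R0.
  split; last by move=> i ip; apply: R0; lia.
  apply: HL => // k kp; have [/eqP ->|?] := boolP (k == p); last by apply: hl; lia.
  have [h|h] := posnP (state x p); last by apply: GH_pos => //; exact: sR.
  by rewrite G1 //; case: tl => t; lia.
Qed.

(* Main.v *)
Require Import Defs.
From HB Require Import structures.
From mathcomp Require Import all_boot all_order all_algebra.
From mathcomp.real_closed Require Import complex.
From mathcomp Require Import all_classical all_reals all_analysis.
From mathcomp Require Import zify ring lra.
Import Order.TTheory GRing.Theory Num.Theory numFieldNormedType.Exports.
Local Open Scope classical_set_scope.
Local Open Scope ring_scope.

(* Write N = e + r.  The characteristic equation rho ^ (N + 1) = rho ^ N + 1 is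
   the recursion for the number of paths of the transition graph, which is
   therefore comparable to rho ^ L for paths of length L.

   Upper bound: by compactness of Z, every open cover is refined by the
   cylinders of some window [-m, m], and what is seen in this window up to time
   n depends only on x on [-m-n, m+n].  There x consists of two paths of the
   graph, so at most about n * rho ^ (2 n) patterns occur.

   Lower bound: right- and left-moving pulses annihilate in pairs, so the place
   of collision drifts away unless both sides send equally many pulses.  By the
   pigeonhole principle, at least rho ^ L / (c L) closed words of length about
   L contain the same number of pulses; concatenating such words on both sides
   keeps the collisions within distance L of the origin, and the window
   [-L, L] then displays every pulse of either side. *)

(** * The largest eigenvalue *)

(** The polynomial is [-1] at [1] and [2 ^+ N - 1] at [2], so it vanishes in between, and not at
    [1]. *)
Lemma perron_root_exists (R : realType) (N : nat) :
  exists2 rho : R, 1 < rho & rho ^+ N.+1 = rho ^+ N + 1.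
Proof.
pose p : {poly R} := 'X^(N.+1) - 'X^N - 1.
have hp x : p.[x] = x ^+ N.+1 - x ^+ N - 1 by rewrite !hornerE.
have [rho /andP[rho1 rho2] /rootP] : exists2 x, x \in `[1, 2] & root p x.
  apply: poly_ivt; first by lra.
  rewrite !hp !expr1n !exprS; apply/andP; split; first by lra.
  have : 1 <= (2 : R) ^+ N by apply: exprn_ege1; lra.
  by lra.
rewrite hp => h; exists rho; last by lra.
rewrite lt_neqAle [1 <= rho]rho1 andbT; apply/eqP => r1.
by move: h; rewrite -r1 !expr1n; lra.
Qed.

(** A positive root satisfies [x ^+ N * (x - 1) = 1], hence exceeds [1], and there the left-hand
    side is strictly increasing. *)
Lemma perron_root_unique {R : realDomainType} (N : nat) (x y : R) :
  0 < x -> 0 < y -> x ^+ N.+1 = x ^+ N + 1 -> y ^+ N.+1 = y ^+ N + 1 -> x = y.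
Proof.
have gt1 (z : R) : 0 < z -> z ^+ N.+1 = z ^+ N + 1 -> 1 < z.
  move=> z0; rewrite exprS ltNge => h; apply/negP => z1.
  have := exprn_gt0 N z0; nra.
have lt (z t : R) : 1 < z -> z ^+ N.+1 = z ^+ N + 1 ->
    t ^+ N.+1 = t ^+ N + 1 -> z < t -> False.
  rewrite !exprS => z1 hz ht zt.
  have : z ^+ N <= t ^+ N by apply: lerXn2r; rewrite ?nnegrE; lra.
  have : 0 < z ^+ N by apply: exprn_gt0; lra.
  nra.
move=> x0 y0 hx hy; have x1 := gt1 _ x0 hx; have y1 := gt1 _ y0 hy.
by case: (ltgtP x y) => // /lt; move/(_ _) => h; exfalso; apply: h.
Qed.

(* The entry at state [a %% N.+1] of the right Perron eigenvector. *)
Definition perron_weight {R : pzSemiRingType} (rho : R) (N a : nat) : R :=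
  rho ^+ ((a + N) %% N.+1).

Lemma perron_weightS {R : pzSemiRingType} (rho : R) (N a : nat) :
  perron_weight rho N a.+1 = rho ^+ (a %% N.+1).
Proof. by rewrite /perron_weight addSnnS modnDr. Qed.

Lemma perron_weight_nonzero {R : pzSemiRingType} (rho : R) (N a : nat) :
  ~~ (N.+1 %| a)%N -> rho * perron_weight rho N a = perron_weight rho N a.+1.
Proof.
case: a => [|a]; first by rewrite dvdn0.
move=> h; rewrite !perron_weightS -exprS; congr (_ ^+ _).
by rewrite modnS (negbTE h).
Qed.

(** At a multiple of [N.+1] the two weights are [rho ^+ N] and [1], so this is the characteristic
    equation itself. *)
Lemma perron_weight_zero {R : pzSemiRingType} (rho : R) (N a : nat) :
  rho ^+ N.+1 = rho ^+ N + 1 -> (N.+1 %| a)%N ->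
  rho * perron_weight rho N a = perron_weight rho N a + perron_weight rho N a.+1.
Proof.
move=> hrho h; rewrite perron_weightS /perron_weight -modnDml.
move: h; rewrite /dvdn => /eqP ->.
by rewrite add0n modn_small // -exprS expr0.
Qed.

Lemma perron_weight_ge1 {R : realDomainType} (rho : R) (N a : nat) :
  1 < rho -> 1 <= perron_weight rho N a.
Proof. by move=> /ltW; apply: exprn_ege1. Qed.

Lemma perron_weight_le {R : realDomainType} (rho : R) (N a : nat) :
  1 < rho -> perron_weight rho N a <= rho ^+ N.
Proof.
move=> /ltW h; rewrite /perron_weight ler_weXn2l // -ltnS.
exact: ltn_pmod.
Qed.

Lemma transition_row_sum {R : pzSemiRingType} (e r : nat) (i : cell e r)
    (f : nat -> R) : (0 < e + r)%N ->
  \sum_j transition_mx R e r i j * f j =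
  (if (i == 0 :> nat) then f 0%N else 0) + f (i.+1 %% (e + r).+1)%N.
Proof.
move=> N0; pose k : cell e r := inord (i.+1 %% (e + r).+1).
have kE : k = (i.+1 %% (e + r).+1)%N :> nat by rewrite inordK // ltn_pmod.
have transE j : transition_mx R e r i j * f j =
    (if j == ord0 then (if (i == 0 :> nat) then f 0%N else 0) else 0) +
    (if j == k then f (i.+1 %% (e + r).+1)%N else 0).
  rewrite mxE /transition -!val_eqE /= kE.
  have [iN|iN] := eqVneq (i : nat) (e + r)%N.
    rewrite iN modnn [(_ + _ == 0)%N]gtn_eqF //=.
    rewrite [j == (e + r).+1 :> nat]ltn_eqF //=.
    by case: eqP => [->|_]; rewrite ?mul1r ?mul0r add0r.
  have ilt : (i < e + r)%N by have := ltn_ord i; rewrite ltnS leq_eqVlt (negbTE iN).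
  rewrite modn_small ?ltnS // orbF.
  case: eqP => [i0|i0]; case: eqP => [j0|j0]; case: eqP => [j1|j1] //=;
    rewrite ?mul1r ?mul0r ?addr0 ?add0r ?j0 ?j1 //; lia.
under eq_bigr do rewrite transE.
by rewrite big_split /= -!big_mkcond /= !big_pred1_eq.
Qed.

(** The ring is general because the identity serves over [R] for the eigenvalue and over [R[i]] for
    its dominance. *)
Lemma transition_right_eigenvector {R : comPzSemiRingType} (e r : nat) (rho : R)
    (i : cell e r) :
  (0 < e + r)%N -> rho ^+ (e + r).+1 = rho ^+ (e + r) + 1 ->
  \sum_j transition_mx R e r i j * perron_weight rho (e + r) j =
  rho * perron_weight rho (e + r) i.
Proof.
move=> N0 hrho; rewrite (transition_row_sum _ _ _ (perron_weight rho (e + r))) //.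
have -> : perron_weight rho (e + r) (i.+1 %% (e + r).+1) =
    perron_weight rho (e + r) i.+1.
  by rewrite /perron_weight modnDml.
case: eqP => [->|i0].
  by rewrite perron_weight_zero ?dvdn0 // addrC.
rewrite add0r perron_weight_nonzero // /dvdn modn_small //.
by apply/eqP.
Qed.

(** Dominance: for a row eigenvector [v] of [z] and the positive right eigenvector [w], the triangle
    inequality bounds [|z|] times the sum of the [|v_j| w_j] by [rho] times the same sum, which is
    positive. *)
Lemma transition_largest_eigenvalue (R : realType) (e r : nat) (rho : R) :
  (0 < e + r)%N ->
  1 < rho -> rho ^+ (e + r).+1 = rho ^+ (e + r) + 1 ->
  is_largest_eigenvalue (transition_mx R e r) rho.
Proof.
move=> N0 rho1 hrho; split.
  (* [eigenvalue] refers to row vectors, whereas the Perron vector is a column; it shows that the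
     matrix minus [rho] is singular, which suffices. *)
  rewrite /eigenvalue /eigenspace kermx_eq0 row_free_unit; apply/negP => inv.
  pose w : 'cV[R]_(e + r).+1 := \col_j perron_weight rho (e + r) j.
  have w0 : (transition_mx R e r - rho%:M) *m w = 0.
    rewrite mulmxBl mul_scalar_mx; apply/colP => i; rewrite !mxE.
    under eq_bigr do rewrite [w _ _]mxE.
    by rewrite transition_right_eigenvector // subrr.
  have /colP/(_ ord0) : w = 0 by rewrite -(mulKmx inv w) w0 mulmx0.
  rewrite !mxE => w00; have := perron_weight_ge1 rho (e + r) 0 rho1.
  by rewrite w00 ler10.
move=> z /eigenvalueP[v vz v0].
have mapE : map_mx (real_complex R) (transition_mx R e r) =
    transition_mx R[i] e r.
  by apply/matrixP => i j; rewrite !mxE rmorph_nat.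
rewrite {}mapE in vz.
pose w j : R[i] := perron_weight (rho%:C)%C (e + r) j.
have w_gt0 j : 0 < w j by apply: exprn_gt0; rewrite ltcR; lra.
have hrhoC : (rho%:C)%C ^+ (e + r).+1 = (rho%:C)%C ^+ (e + r) + 1 :> R[i].
  by rewrite -!rmorphXn -(rmorph1 (real_complex R)) -rmorphD -hrho.
have S_gt0 : 0 < \sum_j `|v 0 j| * w j.
  have /rV0Pn[k vk] := v0.
  rewrite (bigD1 k) //=; apply: ltr_wpDr.
    by apply: sumr_ge0 => j _; rewrite mulr_ge0 // ltW.
  by rewrite mulr_gt0 // normr_gt0.
rewrite -(ler_pM2r S_gt0) !mulr_sumr.
apply: (@le_trans _ _ (\sum_j (\sum_i `|v 0 i| * transition_mx R[i] e r i j) * w j)).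
  apply: ler_sum => j _; rewrite mulrA; apply: ler_wpM2r; first exact: ltW.
  have /rowP/(_ j) := vz; rewrite !mxE -normrM => <-.
  apply: le_trans (ler_norm_sum _ _ _) _; apply: ler_sum => i _.
  by rewrite normrM mxE normr_nat.
under eq_bigr do rewrite mulr_suml.
rewrite exchange_big /=; apply: ler_sum => i _.
under eq_bigr do rewrite -mulrA.
by rewrite -mulr_sumr transition_right_eigenvector // mulrCA.
Qed.

(** * Counting paths of the transition graph *)

(* A path of the transition graph is coded by the bits telling at which steps
   its state changes; [a] is the initial state, and states are counted upwards
   without reduction modulo [N.+1]. *)
Fixpoint admissible (N a : nat) (s : seq bool) : bool :=
  if s is b :: s' then (b || (N.+1 %| a)%N) && admissible N (a + b) s' else true.

Fixpoint words (N L a : nat) : seq (seq bool) :=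
  if L is L'.+1 then
    [seq true :: s | s <- words N L' a.+1] ++
    (if (N.+1 %| a)%N then [seq false :: s | s <- words N L' a] else [::])
  else [:: [::]].

Lemma mem_words (N L a : nat) (s : seq bool) :
  (s \in words N L a) = (size s == L) && admissible N a s.
Proof.
have cons_inj b : injective (cons b : seq bool -> seq bool) by move=> ? ? [].
have consF b c (t : seq bool) ss :
    b != c -> (b :: t \in [seq c :: s | s <- ss]) = false.
  by move=> /eqP bc; apply/negP => /mapP[? _ [? _]]; apply: bc.
elim: L a s => [|L IH] a [|b s] //=.
  apply/negP; rewrite mem_cat => /orP[/mapP[]//|].
  by case: ifP => // _ /mapP[].
rewrite mem_cat eqSS; case: b; rewrite ?orTb ?orFb ?addn1 ?addn0.
  rewrite mem_map // IH; case: ifP => _; last by rewrite orbF.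
  by rewrite consF // orbF.
rewrite consF //; case: ifP => h /=; last by rewrite andbF.
by rewrite mem_map // IH.
Qed.

Lemma words_uniq (N L a : nat) : uniq (words N L a).
Proof.
have cons_inj b : injective (cons b : seq bool -> seq bool) by move=> ? ? [].
elim: L a => //= L IH a; rewrite cat_uniq map_inj_uniq // IH /=.
case: ifP => _ //=; rewrite map_inj_uniq // IH andbT.
by apply/hasPn => _ /mapP[s _ ->]; apply/negP => /mapP[].
Qed.

Lemma size_words {R : pzSemiRingType} (N L a : nat) :
  ((size (words N L.+1 a))%:R = (size (words N L a.+1))%:R +
    (if (N.+1 %| a)%N then (size (words N L a))%:R else 0) :> R).
Proof. by rewrite /= size_cat size_map; case: ifP; rewrite ?size_map natrD. Qed.

(** Both the number of words and [perron_weight rho N a * rho ^+ L] obey the recursion of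
    [size_words], so a comparison at [L = 0], where the weight lies between [1] and [rho ^+ N],
    propagates to all [L]. The upper bound below follows in the same way. *)
Lemma size_words_ge {R : realFieldType} (rho : R) (N L a : nat) :
  1 < rho -> rho ^+ N.+1 = rho ^+ N + 1 ->
  perron_weight rho N a * rho ^+ L <= rho ^+ N * (size (words N L a))%:R.
Proof.
move=> rho1 hrho; elim: L a => [|L IH] a.
  by rewrite expr0 !mulr1 perron_weight_le.
rewrite size_words exprS mulrA [_ * rho]mulrC mulrDr; case: ifPn => h.
  rewrite perron_weight_zero // mulrDl addrC.
  by apply: lerD; exact: IH.
by rewrite perron_weight_nonzero // mulr0 addr0.
Qed.

Lemma size_words_le {R : realFieldType} (rho : R) (N L a : nat) :
  1 < rho -> rho ^+ N.+1 = rho ^+ N + 1 ->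
  (size (words N L a))%:R <= perron_weight rho N a * rho ^+ L.
Proof.
move=> rho1 hrho; elim: L a => [|L IH] a.
  by rewrite expr0 mulr1 perron_weight_ge1.
rewrite size_words exprS mulrA [_ * rho]mulrC; case: ifPn => h.
  rewrite perron_weight_zero // mulrDl addrC.
  by apply: lerD; exact: IH.
by rewrite perron_weight_nonzero // addr0.
Qed.

Lemma admissible_cat (N a : nat) (s t : seq bool) :
  admissible N a (s ++ t) = admissible N a s && admissible N (a + count id s) t.
Proof.
elim: s a => [|b s IH] a /=; first by rewrite addn0.
by rewrite IH andbA addnA.
Qed.

Lemma admissible_dvd (N a b : nat) (s : seq bool) :
  (N.+1 %| b)%N -> admissible N (a + b) s = admissible N a s.
Proof.
move=> hb; elim: s a => [|c s IH] a //=.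
by rewrite addnAC IH dvdn_addl.
Qed.

Lemma admissible_nseq (N a n : nat) : admissible N a (nseq n true).
Proof. by elim: n a => //= n IH a; rewrite IH. Qed.

(** The unreduced state after [i] steps of the path that starts at [0]. Past the end of the word it
    stays constant. *)
Definition height (s : seq bool) (i : nat) : nat := count id (take i s).

Lemma height0 (s : seq bool) : height s 0 = 0%N.
Proof. by rewrite /height take0. Qed.

(** The alternative has to hold for every [i]: past the end of [s] the path rests at height
    [count id s], which is legal because this is a multiple of [N.+1]. *)
Lemma heightS (N : nat) (s : seq bool) (i : nat) :
  admissible N 0 s -> (N.+1 %| count id s)%N ->
  height s i.+1 = (height s i).+1 \/
  (height s i.+1 = height s i /\ (N.+1 %| height s i)%N).
Proof.
move=> ads cs; have [si|si] := leqP (size s) i.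
  by right; rewrite /height !take_oversize // ltnW // ltnS.
rewrite /height (take_nth false si) -cats1 count_cat /= addn0.
case E : (nth false s i); first by left; rewrite addn1.
right; rewrite addn0; split=> //; move: ads.
rewrite -{1}(cat_take_drop i s) admissible_cat => /andP[_].
by rewrite (drop_nth false si) /= E add0n => /andP[].
Qed.

Lemma height_mono (s : seq bool) (i j : nat) :
  (i <= j)%N -> (height s i <= height s j)%N.
Proof.
move=> ij; rewrite /height -(take_takel s ij) -{2}(cat_take_drop i (take j s)).
by rewrite count_cat leq_addr.
Qed.

Lemma height_inj (s t : seq bool) :
  size s = size t -> (forall i, (i <= size s)%N -> height s i = height t i) -> s = t.
Proof.
move=> st h; apply: (@eq_from_nth _ false) => // i si.
have := h i.+1 si; rewrite /height (take_nth false si) (take_nth false) -?st //.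
rewrite -!cats1 !count_cat /= !addn0 -[count id (take i t)](h i (ltnW si)).
by rewrite /height => /addnI; do 2!case: nth.
Qed.

Lemma height_flatten (L J : nat) (ss : seq (seq bool)) (j : nat) :
  {in ss, forall s, size s = L /\ count id s = J} -> (j <= size ss)%N ->
  height (flatten ss) (j * L) = (j * J)%N.
Proof.
elim: ss j => [|s ss IH] [|j] // h jss; first by rewrite !mul0n height0.
have [sL sJ] := h s (mem_head _ _).
rewrite /height /= take_cat sL mulSn ltnNge leq_addr /= count_cat sJ addKn.
rewrite [count id (take _ _)]IH //.
by move=> t tss; apply: h; rewrite inE tss orbT.
Qed.

(** * Dynamics of colliding pulses *)

(* [F] and [G] are the unreduced states carried by the right- and left-moving
   pulses; where both are present, the one that is ahead is visible. *)
Lemma GH_lift (e r : nat) (x : config e r) (F G : int -> nat) :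
  (0 < e)%N -> (0 < r)%N ->
  (forall k : int, F (k - 1) = (F k).+1 \/ (F (k - 1) = F k /\ ((e + r).+1 %| F k)%N)) ->
  (forall k : int, G (k + 1) = (G k).+1 \/ (G (k + 1) = G k /\ ((e + r).+1 %| G k)%N)) ->
  (forall k, state x k = (maxn (F k) (G k) %% (e + r).+1)%N) ->
  forall k, state (GH x) k = (maxn (F (k - 1)%R) (G (k + 1)%R) %% (e + r).+1)%N.
Proof.
move=> e0 r0 hF hG hx k.
have [g1 g2 g3 g4] := state_GH e0 x k.
have hxk := hx k; have hxl := hx (k - 1); have hxr := hx (k + 1).
have Fl := hF k; have := hF (k + 1); rewrite addrK => Fr.
have Gr := hG k; have := hG (k - 1); rewrite subrK => Gl.
have modSn n : ((n.+1 %% (e + r).+1) =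
    if (e + r).+1 %| n.+1 then 0 else (n %% (e + r).+1).+1)%N := modnS n _.
have modlt n : (n %% (e + r).+1 < (e + r).+1)%N by rewrite ltn_pmod.
have predN n : ((e + r).+1 %| n.+1)%N -> (n %% (e + r).+1 = e + r)%N.
  move=> h; move: h (modSn n) (modlt n); rewrite /dvdn => /eqP h.
  have : (((n %% (e + r).+1).+1) %% (e + r).+1 = 0)%N.
    by rewrite -[(n %% _).+1]addn1 modnDml addn1.
  have := modlt n; rewrite ltnS leq_eqVlt => /predU1P[//|lt].
  by rewrite modn_small.
move: hxk; set H := maxn (F k) (G k) => hxk.
have [HF HG Hor] : [/\ (F k <= H)%N, (G k <= H)%N & H = F k \/ H = G k].
  by rewrite /H; clear; split; lia.
(* If the visible state is nonzero, a pulse attaining the maximum [H] cannot rest, so the maximum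
   becomes [H.+1], just as the local rule advances the state. *)
have [H0|H0] := boolP ((e + r).+1 %| H)%N; last first.
  have hp : (0 < state x k)%N by rewrite hxk lt0n.
  have -> : maxn (F (k - 1)%R) (G (k + 1)%R) = H.+1.
    have FH : F k = H -> F (k - 1) = H.+1.
      by move=> E; case: Fl => [->|[_]]; rewrite E // => h; case/negP: H0.
    have GSH : G k = H -> G (k + 1) = H.+1.
      by move=> E; case: Gr => [->|[_]]; rewrite E // => h; case/negP: H0.
    have {}Fl : (F (k - 1)%R <= (F k).+1)%N by case: Fl => [|[]] ->.
    have {}Gr : (G (k + 1)%R <= (G k).+1)%N by case: Gr => [|[]] ->.
    by clear -HF HG Hor FH GSH Fl Gr; lia.
  rewrite modSn -hxk; case: ifPn => h.
    by apply: g4 => //; rewrite hxk predN.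
  apply: g3; rewrite hp /= ltn_neqAle -ltnS (leq_ltn_trans (state_le _ _)) // andbT.
  apply: contra h => /eqP; rewrite hxk => h.
  by rewrite /dvdn -[H.+1]addn1 -modnDml h addn1 modnn.
have x0 : state x k = 0%N by rewrite hxk; apply/eqP.
have HS : (H.+1 %% (e + r).+1 = 1)%N.
  by rewrite -[H.+1]addn1 -modnDml (eqP H0) modn_small // ltnS addn_gt0 e0.
have {}Fl : F (k - 1) = (F k).+1 \/ F (k - 1) = F k by case: Fl => [|[]]; auto.
have {}Fr : F k = (F (k + 1)%R).+1 \/ F k = F (k + 1) by case: Fr => [|[]]; auto.
have {}Gl : G k = (G (k - 1)).+1 \/ G k = G (k - 1) by case: Gl => [|[]]; auto.
have {}Gr : G (k + 1) = (G k).+1 \/ G (k + 1) = G k by case: Gr => [|[]]; auto.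
(* At a cell in state [0], the maximum grows exactly when some neighbour displays [H.+1], which is
   excited. Otherwise the neighbours display [H] or [H - 1], whose residues [0] and [e + r] are not
   excited, the latter because [r > 0]. *)
have not_excited n : n = H \/ H = n.+1 -> ~ (1 <= n %% (e + r).+1 <= e)%N.
  case=> [->|E]; first by rewrite (eqP H0).
  rewrite predN -?E // => /andP[_]; by rewrite -[X in (_ <= X)%N]addn0 leq_add2l leqNgt r0.
have [/eqP h|h] := boolP (maxn (F (k - 1)%R) (G (k + 1)%R) == H.+1).
  rewrite h HS; apply: g1 => //; rewrite hxl hxr.
  have [E|E] : maxn (F (k - 1)%R) (G (k - 1)%R) = H.+1 \/
               maxn (F (k + 1)%R) (G (k + 1)%R) = H.+1.
    by clear -HF HG Hor Fl Fr Gl Gr h; lia.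
  - by left; rewrite E HS.
  - by right; rewrite E HS.
have E : [/\ maxn (F (k - 1)%R) (G (k + 1)%R) = H,
    maxn (F (k - 1)%R) (G (k - 1)%R) = H \/ H = (maxn (F (k - 1)%R) (G (k - 1)%R)).+1 &
    maxn (F (k + 1)%R) (G (k + 1)%R) = H \/ H = (maxn (F (k + 1)%R) (G (k + 1)%R)).+1].
  by clear -HF HG Hor Fl Fr Gl Gr h; split; lia.
case: E => -> El Er; rewrite (eqP H0).
by apply: g2 => //; rewrite ?hxl ?hxr; apply: not_excited.
Qed.

Lemma GH_iter_lift (e r : nat) (x : config e r) (F G : int -> nat) :
  (0 < e)%N -> (0 < r)%N ->
  (forall k : int, F (k - 1) = (F k).+1 \/ (F (k - 1) = F k /\ ((e + r).+1 %| F k)%N)) ->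
  (forall k : int, G (k + 1) = (G k).+1 \/ (G (k + 1) = G k /\ ((e + r).+1 %| G k)%N)) ->
  (forall k, state x k = (maxn (F k) (G k) %% (e + r).+1)%N) ->
  forall (t : nat) k, state (iter t (@GH e r) x) k =
    (maxn (F (k - t%:Z)%R) (G (k + t%:Z)%R) %% (e + r).+1)%N.
Proof.
move=> e0 r0 hF hG hx; elim=> [|t IH] k /=.
  by rewrite hx; congr (maxn (F _) (G _) %% _)%N; lia.
rewrite (@GH_lift _ _ _ (fun k => F (k - t%:Z)) (fun k => G (k + t%:Z))) //.
- by congr (maxn (F _) (G _) %% _)%N; lia.
- move=> {}k; have := hF (k - t%:Z).
  by rewrite (_ : k - t%:Z - 1 = k - 1 - t%:Z) //; lia.
- move=> {}k; have := hG (k + t%:Z).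
  by rewrite (_ : k + t%:Z + 1 = k + 1 + t%:Z) //; lia.
Qed.

(** * Configurations built from two words *)

Definition posp (k : int) : nat := if k is Posz n then n else 0%N.

(** The word [s] is read from the origin to the left and [t] to the right. On each side the other
    height is [0], so that the maximum only puts the configuration in the form required by
    [GH_iter_lift]. *)
Definition two_sided (e r : nat) (s t : seq bool) : config e r := fun k =>
  inord (maxn (height s (posp (- k)%R)) (height t (posp k)) %% (e + r).+1).

Lemma state_two_sided (e r : nat) (s t : seq bool) (k : int) :
  state (two_sided e r s t) k =
  (maxn (height s (posp (- k)%R)) (height t (posp k)) %% (e + r).+1)%N.
Proof. by rewrite /state inordK // ltn_pmod. Qed.

Lemma height_pospS (N : nat) (s : seq bool) (k : int) :
  admissible N 0 s -> (N.+1 %| count id s)%N ->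
  height s (posp (k + 1)) = (height s (posp k)).+1 \/
  (height s (posp (k + 1)) = height s (posp k) /\ (N.+1 %| height s (posp k))%N).
Proof.
move=> ads cs; case: (leP 0 k) => k0.
  have -> : posp (k + 1) = (posp k).+1 by case: k k0 => // n; rewrite -PoszD addn1.
  exact: heightS.
have [-> ->] : posp (k + 1) = 0%N /\ posp k = 0%N by case: k k0 => // -[].
by right; rewrite height0.
Qed.

Lemma iter_two_sided (e r : nat) (s t : seq bool) (n : nat) (k : int) :
  (0 < e)%N -> (0 < r)%N ->
  admissible (e + r) 0 s -> ((e + r).+1 %| count id s)%N ->
  admissible (e + r) 0 t -> ((e + r).+1 %| count id t)%N ->
  state (iter n (@GH e r) (two_sided e r s t)) k =
  (maxn (height s (posp (n%:Z - k)%R)) (height t (posp (k + n%:Z)%R)) %% (e + r).+1)%N.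
Proof.
move=> e0 r0 ads cs adt ct.
rewrite (@GH_iter_lift _ _ _ (fun k => height s (posp (- k)))
  (fun k => height t (posp k))) //.
- by rewrite opprB.
- by move=> {}k; rewrite opprB addrC; exact: height_pospS.
- by move=> {}k; exact: height_pospS.
- exact: state_two_sided.
Qed.

Lemma pulse_collision_two_sided (e r : nat) (s t : seq bool) :
  admissible (e + r) 0 s -> ((e + r).+1 %| count id s)%N ->
  admissible (e + r) 0 t -> ((e + r).+1 %| count id t)%N ->
  pulse_collision (two_sided e r s t).
Proof.
move=> ads cs adt ct.
have trans (x : config e r) i j u : admissible (e + r) 0 u ->
    ((e + r).+1 %| count id u)%N -> forall k,
    state x i = (height u (posp k) %% (e + r).+1)%N ->
    state x j = (height u (posp (k + 1)) %% (e + r).+1)%N ->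
    transition (x i) (x j).
  move=> adu cu k xi xj; apply/transitionP; rewrite xi xj.
  have [->|[-> /eqP->]] := height_pospS _ _ k adu cu; last by constructor 1.
  rewrite modnS; case: ifP => h; last by constructor 2.
  constructor 3; split=> //.
  have := ltn_pmod (height u (posp k)) (ltn0Sn (e + r)).
  rewrite ltnS leq_eqVlt => /predU1P[//|lt].
  by move: h; rewrite /dvdn -addn1 -modnDml addn1 modn_small.
have posp0 k : k <= 0 -> posp k = 0%N by case: k => // -[].
have L : S_L_plus 0 (two_sided e r s t).
  move=> i i0; apply: (trans _ _ _ t adt ct i); rewrite state_two_sided.
    by rewrite [posp (- i)]posp0 ?height0 ?max0n //; lia.
  by rewrite [posp (- (i + 1))]posp0 ?height0 ?max0n //; lia.
(* Both paths start in state [0] at the origin, which therefore belongs to the left path and to the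
   right one. *)
apply: (@pulse_collisionI _ _ _ 0); last by right; exact: L.
split; last by move=> i i0; apply: L; lia.
move=> i i0; apply: (trans _ _ _ s ads cs (- i)); rewrite state_two_sided.
  by rewrite [posp i]posp0 ?height0 ?maxn0.
by rewrite [posp (i - 1)]posp0 ?height0 ?maxn0 ?opprB 1?addrC //; lia.
Qed.

(** * Lower bound *)

Lemma limn_esup_le {R : realType} (u v : nat -> \bar R) :
  (forall n, (0 < n)%N -> (u n <= v n)%E) -> (limn_esup u <= limn_esup v)%E.
Proof.
move=> uv; rewrite !limn_esup_lim.
apply: lee_lim; [exact: is_cvg_esups|exact: is_cvg_esups|].
exists 1%N => // n /= n0; apply: ge_ereal_sup => _ [m /= nm <-].
apply: (le_trans (uv m (leq_trans n0 nm))); apply: ereal_sup_ubound.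
by exists m.
Qed.

Lemma limn_esup_affine_inv {R : realType} (a c : R) :
  limn_esup (fun n : nat => (a + c * n%:R^-1)%:E) = a%:E.
Proof.
apply: (cvg_limn_einf_sup _).2; apply: cvg_EFin; first exact: nearW.
rewrite /comp /= -[X in _ --> X]addr0 -[X in _ --> _ + X](mulr0 c).
apply: cvgD; first exact: cvg_cst.
apply: cvgM; first exact: cvg_cst.
apply/gtr0_cvgV0; last exact: cvgr_idn.
by exists 1%N => // n /= n0; rewrite ltr0n.
Qed.

(** No member of the cover contains two of the points, so assigning to each point a member
    containing it is injective. *)
Lemma covering_number_ge {R : realType} (X : Type) (U : set (set X))
    (P : finType) (y : P -> X) :
  (forall A, U A -> forall p q, A (y p) -> A (y q) -> p = q) ->
  ((#|P|%:R)%:E <= covering_number R U)%E.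
Proof.
move=> Uinj; apply: le_ereal_inf_tmp => _ [n [V [UV covV]] <-].
rewrite lee_fin ler_nat -[n]card_ord.
have [i hi] := choice (fun p => covV (y p)).
apply: (@leq_card _ _ i) => p q ipq.
by apply: (Uinj _ (UV (i p))) => //; rewrite ipq.
Qed.

Lemma pigeonhole_fiber (T : Type) (n : nat) (f : T -> nat) (s : seq T) :
  all (fun x => f x < n)%N s ->
  exists c, (size s <= n * count (fun x => f x == c) s)%N.
Proof.
case: n => [|n]; first by case: s => // _; exists 0%N.
move=> fs; pose c := [arg max_(i > (ord0 : 'I_n.+1)) count (fun x => f x == i) s].
exists (c : nat); have -> : size s = (\sum_(i < n.+1) count (fun x => f x == i) s)%N.
  elim: s fs {c} => [|x s IH] /=; first by rewrite big1.
  move=> /andP[fx fs]; rewrite IH // big_split /=.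
  rewrite -add1n; congr addn; rewrite (bigD1 (Ordinal fx)) //= eqxx big1 // => i.
  by rewrite -val_eqE /= eq_sym => /negbTE ->.
have cmax (i : 'I_n.+1) :
    (count (fun x => f x == i) s <= count (fun x => f x == c) s)%N.
  by rewrite /c; case: arg_maxnP => // j _; apply.
move: (count _ s) cmax => m cmax.
by rewrite -[n.+1 in X in (_ <= X)%N]card_ord -sum_nat_const leq_sum.
Qed.

(** Since every word returns to state [0] and raises the height by the same [J], words can be
    concatenated freely, and two concatenations have equal heights after equally many blocks. *)
Definition closed_words (N L J : nat) (ws : seq (seq bool)) : Prop :=
  [/\ uniq ws, (N.+1 %| J)%N &
    {in ws, forall s, [/\ size s = L, admissible N 0 s & count id s = J]}].

Lemma closed_words_exist {R : realFieldType} (rho : R) (N L : nat) :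
  1 < rho -> rho ^+ N.+1 = rho ^+ N + 1 ->
  exists M J ws, [/\ closed_words N M J ws, (L <= M <= L + N)%N &
    rho ^+ L <= rho ^+ N * (L.+1%:R * (size ws)%:R)].
Proof.
move=> rho1 hrho.
have [c hc] : exists c, (size (words N L 0) <=
    L.+1 * count (fun s => count id s == c) (words N L 0))%N.
  apply: pigeonhole_fiber; apply/allP => s; rewrite mem_words => /andP[/eqP <- _].
  by rewrite ltnS count_size.
(* As [N] is [-1] modulo [N.+1], this is the number of forced steps that lead from height [c] back
   to state [0]. *)
pose pad := ((N * c) %% N.+1)%N; pose ws0 := [seq s <- words N L 0 | count id s == c].
have cat_inj : injective (fun s : seq bool => s ++ nseq pad true).
  move=> s t /= h; have /eqP st := congr1 size h.
  move: st; rewrite !size_cat eqn_add2r => /eqP st.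
  by move/eqP: h; rewrite eqseq_cat // => /andP[/eqP].
exists (L + pad)%N, (c + pad)%N, [seq s ++ nseq pad true | s <- ws0]; split.
- split.
  + by rewrite map_inj_uniq // filter_uniq // words_uniq.
  + by rewrite /dvdn /pad modnDmr -mulSn modnMr.
  + move=> _ /mapP[s + ->]; rewrite mem_filter mem_words => /and3P[/eqP cs /eqP ss ads].
    rewrite size_cat size_nseq ss count_cat cs count_nseq mul1n.
    by rewrite admissible_cat ads admissible_nseq.
- by rewrite leq_addr leq_add2l -ltnS ltn_pmod.
- have := size_words_ge rho N L 0 rho1 hrho.
  have := perron_weight_ge1 rho N 0 rho1; rewrite size_map size_filter.
  move=> w1 hw; apply: le_trans (_ : rho ^+ N * (size (words N L 0))%:R <= _).
    apply: le_trans hw; rewrite ler_peMl // exprn_ge0 //; lra.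
  by rewrite ler_wpM2l ?exprn_ge0 //; [lra|rewrite -natrM ler_nat].
Qed.

Definition cylinder (e r M : nat) (x : config e r) : set (config e r) :=
  [set y | forall k : int, (`|k|%N <= M)%N -> y k = x k].

Lemma cylinder_open (e r M : nat) (x : config e r) : open (cylinder e r M x).
Proof.
have op k : open [set y : config e r | y k = x k].
  rewrite -[X in open X]/((fun y : config e r => y k) @^-1` [set x k]).
  apply: open_comp; last exact: discrete_open.
  by move=> y _; exact: (@proj_continuous _ (fun _ : int => discrete_topology (cell e r)) k).
elim: M => [|M IH].
  rewrite (_ : cylinder _ _ _ _ = [set y | y 0 = x 0]) //.
  by apply/seteqP; split => [y|y h k]; [apply|case: k => [[|]|] //].
rewrite (_ : cylinder _ _ _ _ = cylinder e r M x `&`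
  ([set y | y M.+1%:Z = x M.+1%:Z] `&` [set y | y (- M.+1%:Z) = x (- M.+1%:Z)])).
  by apply: openI => //; exact: openI.
apply/seteqP; split => y.
  by move=> h; split; [move=> k kM; apply: h; lia|split; apply: h; lia].
case=> h [h1 h2] k; rewrite leq_eqVlt ltnS => /predU1P[kM|]; last exact: h.
by have [->|->] : k = M.+1%:Z \/ k = - M.+1%:Z by lia.
Qed.

(** Heights start at [0] and grow by [0] or [1], two increments that remain distinct modulo [N.+1];
    hence the reduced heights determine the heights. *)
Lemma mod_height_inj (N n : nat) (s t : seq bool) : (0 < N)%N ->
  admissible N 0 s -> (N.+1 %| count id s)%N ->
  admissible N 0 t -> (N.+1 %| count id t)%N ->
  (forall i, (i <= n)%N -> height s i = height t i %[mod N.+1]) ->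
  forall i, (i <= n)%N -> height s i = height t i.
Proof.
move=> N0 ads cs adt ct h; elim=> [|i IH] ni; first by rewrite !height0.
have := h _ ni; have := heightS _ _ i ads cs; have := heightS _ _ i adt ct.
have neS m : m.+1 = m %[mod N.+1] -> False.
  by move/eqP; rewrite -[m.+1]addn1 -{2}[m]addn0 eqn_modDl mod0n modn_small.
by rewrite (IH (ltnW ni)) => -[->|[-> _]] [->|[-> _]] // => [/esym/neS|/neS].
Qed.

Lemma flatten_closed_words (N L J : nat) (ws ss : seq (seq bool)) :
  closed_words N L J ws -> {subset ss <= ws} ->
  [/\ size (flatten ss) = (size ss * L)%N, admissible N 0 (flatten ss) &
    (N.+1 %| count id (flatten ss))%N].
Proof.
move=> [_ hJ hws]; elim: ss => [|s ss IH] ssws //=.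
have [sL ads cs] := hws s (ssws s (mem_head _ _)).
have [|sz ad ct] := IH; first by move=> t tss; apply: ssws; rewrite inE tss orbT.
rewrite size_cat count_cat sz sL admissible_cat ads cs dvdn_addr // ct.
by rewrite admissible_dvd.
Qed.

(** Both heights are compared with [i %/ L * J], the common height after [i %/ L] blocks: index [i]
    is past these blocks, while [i - L] is not. *)
Lemma height_flatten_balanced (N L J : nat) (ws ss tt : seq (seq bool)) (i j : nat) :
  closed_words N L J ws -> {subset ss <= ws} -> {subset tt <= ws} ->
  size ss = size tt -> (0 < L)%N -> (i <= size ss * L)%N -> (j <= i - L)%N ->
  (height (flatten tt) j <= height (flatten ss) i)%N.
Proof.
move=> [_ _ hws] ssws ttws st L0 iss ji.
have h uu : {subset uu <= ws} -> {in uu, forall s, size s = L /\ count id s = J}.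
  by move=> uuws s /uuws /hws[].
have [iL|Li] := ltnP i L.
  have -> : j = 0%N by lia.
  by rewrite height0.
have qi : (i %/ L <= size ss)%N by rewrite -[size ss](mulnK _ L0) leq_div2r.
apply: (@leq_trans (i %/ L * J)).
  rewrite -(height_flatten L J tt) -?st //; last exact: h.
  by apply: height_mono; have := divn_eq i L; have := ltn_pmod i L0; lia.
rewrite -(height_flatten L J ss) //; last exact: h.
by apply: height_mono; rewrite leq_trunc_div.
Qed.

(* Up to time [size ss * L], the cell at [- L] is reached by the pulses from the
   left before those from the right, so that it displays [height (flatten ss)];
   symmetrically at [L]. *)
Lemma two_sided_separated (e r L J n : nat) (ws ss ss' tt tt' : seq (seq bool)) :
  (0 < e)%N -> (0 < r)%N -> (0 < L)%N -> closed_words (e + r) L J ws ->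
  {subset ss <= ws} -> {subset ss' <= ws} ->
  {subset tt <= ws} -> {subset tt' <= ws} ->
  size ss' = size ss -> size tt = size ss -> size tt' = size ss ->
  (0 < n)%N -> (size ss * L <= n)%N ->
  (forall i, (i < n)%N -> cylinder e r L
    (iter i (@GH e r) (two_sided e r (flatten ss) (flatten tt)))
    (iter i (@GH e r) (two_sided e r (flatten ss') (flatten tt')))) ->
  flatten ss = flatten ss' /\ flatten tt = flatten tt'.
Proof.
move=> e0 r0 L0 cws sub1 sub2 sub3 sub4 sz2 sz3 sz4 n0 szn H.
have N0 : (0 < e + r)%N by rewrite addn_gt0 e0.
have [z1 a1 c1] := flatten_closed_words _ _ _ _ _ cws sub1.
have [z2 a2 c2] := flatten_closed_words _ _ _ _ _ cws sub2.
have [z3 a3 c3] := flatten_closed_words _ _ _ _ _ cws sub3.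
have [z4 a4 c4] := flatten_closed_words _ _ _ _ _ cws sub4.
have h1 := iter_two_sided e r _ _ _ _ e0 r0 a1 c1 a3 c3.
have h2 := iter_two_sided e r _ _ _ _ e0 r0 a2 c2 a4 c4.
have agree t k : (t < n)%N -> (`|k|%N <= L)%N ->
    state (iter t (@GH e r) (two_sided e r (flatten ss) (flatten tt))) k =
    state (iter t (@GH e r) (two_sided e r (flatten ss') (flatten tt'))) k.
  by move=> tn kL; rewrite /state H.
(* Index [i] of the left word is read at cell [- i] at time [0] if [i <= L], and at cell [- L] at
   time [i - L] afterwards. The opposite word shows index [t - j] there, too small to prevail. *)
have seen i : (i <= size ss * L)%N -> exists t (j : nat),
    [/\ (t < n)%N, (j <= L)%N, i = (t + j)%N & (t - j <= i - L)%N].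
  have [iL|Li] := leqP i L => hi; first by exists 0%N, i; split=> //; lia.
  by exists (i - L)%N, L; split=> //; lia.
have pospD t j : posp (t%:Z + j%:Z) = (t + j)%N by [].
have pospB t j : posp (t%:Z - j%:Z) = (t - j)%N.
  have [jt|tj] := leqP j t; first by rewrite subzn.
  have -> : (t - j = 0)%N by lia.
  by case E : (t%:Z - j%:Z) => [m|m] //=; lia.
have bal uu vv i j : {subset uu <= ws} -> {subset vv <= ws} -> size uu = size ss ->
    size vv = size ss -> (i <= size ss * L)%N -> (j <= i - L)%N ->
    maxn (height (flatten uu) i) (height (flatten vv) j) = height (flatten uu) i.
  move=> uws vws su sv hi hj; apply/maxn_idPl.
  by apply: (height_flatten_balanced _ _ _ _ _ _ _ _ cws); rewrite ?su ?sv.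
split; apply: height_inj; rewrite ?z1 ?z2 ?z3 ?z4 ?sz2 ?sz3 ?sz4 //;
  apply: (mod_height_inj _ _ _ _ N0) => // i /[dup] hi /seen[t [j [tn jL ij tj]]].
  have jL' : (`|- j%:Z|%N <= L)%N by rewrite abszN.
  have := agree t (- j%:Z) tn jL'.
  rewrite h1 h2 opprK pospD [- j%:Z + _]addrC pospB -ij.
  by rewrite !bal ?sz3 ?sz4.
have := agree t j%:Z tn jL.
rewrite h1 h2 [j%:Z + _]addrC pospD pospB -ij.
by rewrite ![maxn (height _ (t - j)) _]maxnC !bal ?sz3 ?sz4.
Qed.

(** With [n %/ L] blocks on either side, all choices of blocks give configurations that the window
    [[-L, L]] tells apart before time [n]. The map [pi] lets this apply both to the inclusion of [Z]
    and to the identity of [X]. *)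
Lemma entropy_ge_closed_words {R : realType} (e r L J : nat)
    (ws : seq (seq bool)) (Y : topologicalType) (f : Y -> Y)
    (pi : Y -> config e r) :
  (0 < e)%N -> (0 < r)%N -> (0 < L)%N -> (0 < size ws)%N ->
  closed_words (e + r) L J ws ->
  continuous pi -> (forall y, pi (f y) = GH (pi y)) ->
  (forall x, pulse_collision x -> exists y, pi y = x) ->
  ((2 * ln (size ws)%:R / L%:R)%:E <= topological_entropy R f)%E.
Proof.
move=> e0 r0 L0 W0 cws cpi fpi spi.
pose U := [set pi @^-1` cylinder e r L x | x in [set: config e r]].
have cU : open_cover U.
  split=> [_ [x _ <-]|y].
    by apply: open_comp; [move=> y _; exact: cpi|exact: cylinder_open].
  by exists (pi @^-1` cylinder e r L (pi y)); [exists (pi y)|].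
apply: (@le_trans _ _ (cover_entropy R f U)); last first.
  by apply: ereal_sup_ubound; exists U.
have iterpi n y : pi (iter n f y) = iter n (@GH e r) (pi y).
  by elim: n => //= n <-.
have lnW : 0 <= ln (size ws)%:R :> R by rewrite ln_ge0 // ler1n.
(* The constant pays for rounding [n / L] down to [k], since [1 / L <= (k + 1) / n]. *)
rewrite -(limn_esup_affine_inv _ (- (2 * ln (size ws)%:R))).
apply: limn_esup_le => n n0; pose k := (n %/ L)%N.
pose cat (u : k.-tuple 'I_(size ws)) := [seq nth [::] ws i | i : 'I_(size ws) <- u].
have subcat u : {subset cat u <= ws} by move=> _ /mapP[i _ ->]; exact: mem_nth.
have szcat u : size (cat u) = k by rewrite size_map size_tuple.
have ex (p : k.-tuple 'I_(size ws) * k.-tuple 'I_(size ws)) : exists y,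
    pi y = two_sided e r (flatten (cat p.1)) (flatten (cat p.2)).
  have [_ a1 c1] := flatten_closed_words _ _ _ _ _ cws (subcat p.1).
  have [_ a2 c2] := flatten_closed_words _ _ _ _ _ cws (subcat p.2).
  by apply: spi; exact: pulse_collision_two_sided.
have [y hy] := choice ex.
have [uws _ hws] := cws.
(* All blocks have length [L], so a concatenation can be cut back into its blocks. *)
have flatten_inj u v : flatten (cat u) = flatten (cat v) -> u = v.
  have shp w : shape (cat w) = nseq k L.
    apply: (@eq_from_nth _ 0%N) => [|i]; rewrite size_map szcat ?size_nseq // => ik.
    rewrite (nth_map [::]) ?szcat // nth_nseq ik.
    have iw : nth [::] (cat w) i \in cat w by rewrite mem_nth // szcat.
    by have [] := hws _ (subcat w _ iw).
  move=> /eq_from_flatten_shape; rewrite !shp => /(_ erefl) /inj_map h.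
  apply: val_inj; apply: h => i j /eqP.
  by rewrite nth_uniq // => /eqP /val_inj.
have := @covering_number_ge R _ (iterated_join f U n) _ y.
have -> : (#|{: k.-tuple 'I_(size ws) * k.-tuple 'I_(size ws)}|)%:R =
    (size ws)%:R ^+ (k + k) :> R.
  by rewrite card_prod !card_tuple card_ord -expnD natrX.
move=> hcov; apply: (@le_trans _ _ ((n%:R^-1)%:E * lne ((size ws)%:R ^+ (k + k))%:E)%E).
  rewrite lne_EFin ?exprn_gt0 ?ltr0n // -EFinM lee_fin lnXn ?ltr0n //.
  have nR : 0 < n%:R :> R by rewrite ltr0n.
  have LR : 0 < L%:R :> R by rewrite ltr0n.
  have hn : n%:R <= (k%:R + 1) * L%:R :> R.
    rewrite natr1 -natrM ler_nat {1}(divn_eq n L) -/k.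
    by have := ltn_pmod n L0; nia.
  have hL : L%:R^-1 <= (k%:R + 1) * n%:R^-1 :> R.
    by rewrite ler_pdivlMr // mulrC ler_pdivrMr.
  rewrite -[ln _ *+ _]mulr_natr natrD; move: (ln _) lnW => w w0.
  have := ler_wpM2l w0 hL; move: (n%:R^-1) (L%:R^-1) (k%:R) => a b c; lra.
apply: lee_wpmul2l; first by rewrite lee_fin invr_ge0.
rewrite lee_lne ?in_itv /= ?leey ?andbT; last 2 first.
- by rewrite lee_fin exprn_ge0.
- by apply: le_ereal_inf_tmp => _ [m _ <-]; rewrite lee_fin.
apply: hcov => _ [A hA <-] [u v] [u' v'] yA yA'.
have [y1 y2] : flatten (cat u) = flatten (cat u') /\ flatten (cat v) = flatten (cat v').
  apply: (two_sided_separated e r L J n ws) => //; rewrite ?szcat ?leq_trunc_div //.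
  move=> i ni; have [x _ Ax] := hA i.
  have := yA i ni; have := yA' i ni; rewrite /preimage /= -Ax /preimage /= !iterpi !hy /=.
  by move=> h1 h2 j jL; rewrite h1 // h2.
by rewrite (flatten_inj _ _ y1) (flatten_inj _ _ y2).
Qed.

Lemma entropy_lower_bound {R : realType} (e r : nat) (rho : R)
    (Y : topologicalType) (f : Y -> Y) (pi : Y -> config e r) :
  (0 < e)%N -> (0 < r)%N ->
  1 < rho -> rho ^+ (e + r).+1 = rho ^+ (e + r) + 1 ->
  continuous pi -> (forall y, pi (f y) = GH (pi y)) ->
  (forall x, pulse_collision x -> exists y, pi y = x) ->
  ((2 * ln rho)%:E <= topological_entropy R f)%E.
Proof.
move=> e0 r0 rho1 hrho cpi fpi spi; apply/lee_addgt0Pr => eps eps0.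
have lnrho : 0 < ln rho by rewrite ln_gt0.
have rho0 : 0 < rho by lra.
pose d := eps / 4; have d0 : 0 < d by rewrite divr_gt0.
(* [ln (L + 1) <= d (L + 1) - ln d], as [ln x < x]. *)
have lnd (x : R) : 0 < x -> ln x <= d * x - ln d.
  move=> x0; have := ln_sublinear (mulr_gt0 d0 x0).
  by rewrite lnM ?posrE //; lra.
set N := (e + r)%N in hrho *.
(* One [N * ln rho] pays for the factor [rho ^+ N] in the count of words, the other for at most [N]
   letters of padding, and [d - ln d] for the constant part of the bound on [ln (L + 1)]. In total
   [ln (size ws)] loses at most [2 * d] per letter, which doubles to [eps]. *)
have [L0 hL0] : exists L : nat,
    2 * N%:R * ln rho + d - ln d <= d * L%:R /\ (0 < L)%N.
  pose b := (2 * N%:R * ln rho + d - ln d) / d.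
  have := archi_boundP (normr_ge0 b) => hb.
  exists (Num.bound `|b|).+1; split=> //.
  rewrite [d * _]mulrC -ler_pdivrMr // -/b -natr1.
  by have := ler_norm b; lra.
case: hL0 => hL0 L0_gt0.
have [L [J [ws [cws /andP[LL0 LL1] hws]]]] := closed_words_exist rho N L0 rho1 hrho.
have L_gt0 : (0 < L)%N by exact: leq_trans LL0.
have W0 : (0 < size ws)%N.
  rewrite lt0n; apply: contraTneq hws => ->.
  by rewrite mulr0 mulr0 -ltNge exprn_gt0.
have := @entropy_ge_closed_words R _ _ _ _ _ _ f pi e0 r0 L_gt0 W0 cws cpi fpi spi.
move=> le; rewrite -leeBlDr //; apply: le_trans le; rewrite -EFinB lee_fin.
have LR : 0 < L%:R :> R by rewrite ltr0n.
rewrite ler_pdivlMr //.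
have : ln (rho ^+ L0) <= ln (rho ^+ N * (L0.+1%:R * (size ws)%:R)).
  by rewrite ler_ln ?posrE ?mulr_gt0 ?exprn_gt0 ?ltr0n.
rewrite lnM ?posrE ?mulr_gt0 ?exprn_gt0 ?ltr0n //.
rewrite lnM ?posrE ?ltr0n // !lnXn // -[ln rho *+ L0]mulr_natr -[ln rho *+ N]mulr_natr.
have := lnd L0.+1%:R (ltr0Sn _ _); rewrite -natr1.
have L0L : L0%:R <= L%:R :> R by rewrite ler_nat.
have LL0N : L%:R <= L0%:R + N%:R :> R by rewrite -natrD ler_nat.
have := ler_wpM2l (ltW d0) L0L; have := ler_wpM2l (ltW lnrho) LL0N.
move: hL0; rewrite (_ : eps = 4 * d); last by rewrite /d mulrC divfK.
by lra.
Qed.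

(** * Upper bound *)

(** Otherwise points of the successive cylinders outside [A] would converge to [x] in each
    coordinate, hence in the product topology. *)
Lemma nbhs_cylinder (e r : nat) (x : config e r) (A : set (config e r)) :
  nbhs x A -> exists M, cylinder e r M x `<=` A.
Proof.
move=> Ax; apply: contrapT => /forallNP noM.
have ex M : exists y, cylinder e r M x y /\ ~ A y.
  apply: contrapT => /forallNP h; apply: (noM M) => y xy.
  by apply: contrapT => nA; apply: (h y).
have [y hy] := choice ex.
have : y @ \oo --> x.
  apply/cvg_sup => i B [_ [[W oW <-] Wx] WB]; exists `|i|%N => // M /= iM.
  by apply: WB; rewrite /preimage /= (hy M).1.
move=> /(_ A Ax) [M _ yA]; exact: (hy M).2 (yA M (leqnn M)).
Qed.

(** The condition defining [Z], at an arbitrary position instead of the maximal separating one. For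
    fixed [q] it is a conjunction of conditions on neighbouring cells, hence closed. *)
Definition meets_at (e r : nat) (q : int) (x : config e r) : Prop :=
  [/\ S_R_minus q x, S_L_plus (q + 1) x &
    state x q = state x (q + 1) \/ transition (x q) (x (q + 1))].

Lemma pulse_collisionE (e r : nat) (x : config e r) :
  pulse_collision x <-> S_R x \/ S_L x \/ exists q, meets_at e r q x.
Proof.
split=> [[xR|[xL|[_ [p [[[sR sL] _] [E|[_ sL']]]]]]]|[xR|[xL|[q [sR sL h]]]]].
- by left.
- by right; left.
- by right; right; exists p; split=> //; left; rewrite /state E.
- by right; right; exists p; split=> //; right; exact: sL'.
- by left.
- by right; left.
- exact: (@pulse_collisionI _ _ _ q).
Qed.


(** A point outside [Z] violates the rule of [S_R] at some [i] and that of [S_L] at some [j]. A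
    nearby point of [Z] then meets at some [q] with [j <= q < i], and each of these finitely many
    [q] is excluded on a cylinder. *)
Lemma pulse_collision_closed (e r : nat) : closed (@pulse_collision e r).
Proof.
have trans_eq (x y : config e r) i j : y i = x i -> y j = x j ->
    transition (y i) (y j) -> transition (x i) (x j) by move=> -> ->.
have meets_open q (x : config e r) : ~ meets_at e r q x ->
    exists M, forall y, cylinder e r M x y -> ~ meets_at e r q y.
  move=> nx; apply: contrapT => /forallNP h; apply: nx.
  have {}h M : exists y, cylinder e r M x y /\ meets_at e r q y.
    apply: contrapT => /forallNP hM; apply: (h M) => y xy my; exact: hM y (conj xy my).
  split.
  - move=> i iq; have [y [xy [yR _ _]]] := h (`|i|.+1)%N.
    by apply: trans_eq (yR i iq); apply: xy; lia.
  - move=> i iq; have [y [xy [_ yL _]]] := h (`|i|.+1)%N.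
    by apply: trans_eq (yL i iq); apply: xy; lia.
  - have [y [xy [_ _ yq]]] := h (`|q|.+1)%N.
    case: yq => yq; [left|right; apply: trans_eq yq; apply: xy; lia].
    by move: yq; rewrite /state !xy //; lia.
rewrite -[X in closed X]setCK closedC openE => x nZ.
suff [M hM] : exists M, forall y, cylinder e r M x y -> ~ pulse_collision y.
  apply: (@filterS _ _ _ (cylinder e r M x)) hM _.
  by apply: open_nbhs_nbhs; split=> //; exact: cylinder_open.
have /existsNP[i hi] : ~ S_R x by move=> h; apply: nZ; left.
have /existsNP[j hj] : ~ S_L x by move=> h; apply: nZ; right; left.
have ex q : exists M, forall y, cylinder e r M x y -> ~ meets_at e r q y.
  apply: meets_open => h; apply: nZ; apply/pulse_collisionE.
  by right; right; exists q.
have [B hB] := choice ex.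
pose K := (`|i| + `|j|)%N.
(* The sum over all positions of [[-K, K]] dominates each radius [B q] that may occur. *)
exists (K.+1 + \sum_(n < K.*2.+1) B (n%:Z - K%:Z)%R)%N => y xy.
have xyK k : (`|k|%N <= K.+1)%N -> y k = x k.
  by move=> kK; apply: xy; apply: leq_trans kK _; rewrite leq_addr.
move=> /pulse_collisionE[yR|[yL|[q my]]].
- by apply: hi; apply: trans_eq (yR i); apply: xyK; rewrite /K; lia.
- by apply: hj; apply: trans_eq (yL j); apply: xyK; rewrite /K; lia.
have [yR yL _] := my.
have qi : q < i.
  rewrite ltNge; apply/negP => iq; apply: hi.
  by apply: trans_eq (yR i iq); apply: xyK; rewrite /K; lia.
have jq : j <= q.
  rewrite leNgt; apply/negP => qj; apply: hj.
  by apply: trans_eq (yL j _); [apply: xyK|apply: xyK|]; rewrite /K; lia.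
have nK : (`|(q + K%:Z)%R| < K.*2.+1)%N by rewrite /K; lia.
apply: (hB q y) my => k kB; apply: xy; apply: leq_trans kB _.
rewrite (bigD1 (Ordinal nK)) //= (_ : `|(q + K%:Z)%R|%N%:Z - K%:Z = q); last by rewrite /K; lia.
by rewrite addnCA leq_addr.
Qed.

Lemma pulse_collision_compact (e r : nat) : compact (@pulse_collision e r).
Proof.
apply: (@subclosed_compact _ _ setT) => //; first exact: pulse_collision_closed.
have fin : finite_set [set: discrete_topology (cell e r)].
  exact: (@finite_finset (cell e r)).
have := @tychonoff int (fun _ => discrete_topology (cell e r)) (fun _ => setT)
  (fun _ => finite_compact fin).
by congr compact; apply/seteqP; split.
Qed.

(** Lebesgue's number lemma. If [x m] is a counterexample for each [m], a cluster point has a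
    cylinder of some radius [k] inside a member of [U]; it contains some [x m] with [m >= k], and
    with it the whole cylinder of radius [m] around [x m]. *)
Lemma pulse_collision_lebesgue (e r : nat)
    (U : set (set (set_type (@pulse_collision e r)))) :
  open_cover U -> exists m, forall x : set_type (@pulse_collision e r),
    exists2 A, U A & forall y : set_type (@pulse_collision e r),
      cylinder e r m (set_val x) (set_val y) -> A y.
Proof.
move=> [Uo Uc]; apply: contrapT => /forallNP h.
have ex m : exists x : set_type (@pulse_collision e r), forall A, U A ->
    exists y, cylinder e r m (set_val x) (set_val y) /\ ~ A y.
  have /existsNP[x hx] := h m; exists x => A UA; apply: contrapT => /forallNP hA.
  by apply: hx; exists A => // y xy; apply: contrapT => nA; apply: (hA y).
have [x hx] := choice ex.
have [z [Zz cz]] : @pulse_collision e r `&` cluster ((set_val \o x) @ \oo) !=set0.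
  apply: pulse_collision_compact; exists 0%N => // m _; exact: set_valP.
pose zz : set_type (@pulse_collision e r) := exist _ z (mem_set Zz).
have [A UA Az] := Uc zz.
have [W oW WA] := Uo A UA.
have [k kW] : exists k, cylinder e r k z `<=` W.
  apply: nbhs_cylinder; apply: open_nbhs_nbhs; split=> //.
  by move: Az; rewrite -WA.
have [_ [[m /= km <-] zm]] := cz [set set_val (x m) | m in [set m | (k <= m)%N]]
  (cylinder e r k z) ltac:(by exists k => // m km; exists m)
  ltac:(by apply: open_nbhs_nbhs; split=> //; exact: cylinder_open).
have [y [xy nAy]] := hx m A UA; apply: nAy; rewrite -WA; apply: kW => i ik.
by rewrite xy ?zm // (leq_trans ik).
Qed.

(** * Coding configurations on a window *)

Fixpoint path_bits (T : eqType) (g : nat -> T) (L : nat) : seq bool :=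
  if L is L'.+1 then (g 1%N != g 0%N) :: path_bits T (fun i => g i.+1) L'
  else [::].

Lemma transition_neq (e r : nat) (i j : cell e r) :
  transition i j -> j != i -> j = (i.+1 %% (e + r).+1)%N :> nat.
Proof.
move=> /or3P[/andP[/eqP i0 /eqP j0]|/eqP ij|/andP[/eqP iN /eqP j0]] ji.
- by case/eqP: ji; apply: val_inj; rewrite /= i0 j0.
- by rewrite ij modn_small // -ij.
- by rewrite iN j0 modnn.
Qed.

Lemma transition_refl (e r : nat) (i : cell e r) : transition i i -> i = 0%N :> nat.
Proof.
by move=> /or3P[/andP[/eqP->]//|/eqP ii|/andP[_ /eqP->]//]; exfalso; clear -ii; lia.
Qed.

Lemma path_bits_words (e r : nat) (g : nat -> cell e r) (L a : nat) :
  a = g 0%N %[mod (e + r).+1] -> (forall i, (i < L)%N -> transition (g i) (g i.+1)) ->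
  path_bits _ g L \in words (e + r) L a.
Proof.
elim: L g a => [|L IH] g a ag tg; first by rewrite mem_seq1.
rewrite mem_words /= eqSS.
have t0 := tg 0%N (ltn0Sn _).
have : a + (g 1%N != g 0%N) = g 1%N %[mod (e + r).+1].
  have [->|ne] := eqVneq (g 1%N) (g 0%N); first by rewrite addn0.
  rewrite (transition_neq _ _ _ _ t0 ne) modn_mod addn1 -addn1.
  by rewrite -modnDml ag modnDml addn1.
move=> /IH /(_ (fun i iL => tg i.+1 iL)); rewrite mem_words => /andP[-> ->].
rewrite andbT /=; case: eqP => //= E; rewrite /dvdn ag.
by move: t0; rewrite E => /transition_refl ->; rewrite mod0n.
Qed.

(** A state has only one successor different from itself, so the initial state and the times of
    change determine the path. *)
Lemma path_bits_inj (e r : nat) (g h : nat -> cell e r) (L : nat) :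
  (forall i, (i < L)%N -> transition (g i) (g i.+1)) ->
  (forall i, (i < L)%N -> transition (h i) (h i.+1)) ->
  g 0%N = h 0%N -> path_bits _ g L = path_bits _ h L ->
  forall i, (i <= L)%N -> g i = h i.
Proof.
elim: L g h => [|L IH] g h tg th gh0 /=; first by move=> _ [].
have tg0 := tg 0%N (ltn0Sn _); have th0 := th 0%N (ltn0Sn _).
move=> [b1 bs] [|i] // iL.
apply: (IH (fun i => g i.+1) (fun i => h i.+1)) => // [j jL|j jL|];
  [exact: tg|exact: th|].
move: b1; have [->|g1] := eqVneq (g 1%N) (g 0%N).
  by have [->|] := eqVneq (h 1%N) (h 0%N).
have [->|h1 _] := eqVneq (h 1%N) (h 0%N) => //.
apply: val_inj; rewrite /= (transition_neq _ _ _ _ tg0 g1).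
by rewrite (transition_neq _ _ _ _ th0 h1) gh0.
Qed.

Lemma cylinder_iter_GH (e r m n : nat) (x y : config e r) :
  cylinder e r (m + n) x y ->
  cylinder e r m (iter n (@GH e r) x) (iter n (@GH e r) y).
Proof.
elim: n m => [|n IH] m xy; first by rewrite addn0 in xy.
have {}xy : cylinder e r m.+1 (iter n (@GH e r) x) (iter n (@GH e r) y).
  by apply: IH; rewrite addSnnS.
by move=> k km /=; rewrite /GH !xy //; lia.
Qed.

Lemma covering_number_le {R : realType} (X : Type) (f : X -> X) (U : set (set X))
    (n : nat) (C : eqType) (codes : seq C) (code : X -> C) (x0 : X) :
  (forall x, code x \in codes) ->
  (forall x, exists A : nat -> set X, (forall i, U (A i)) /\
    forall y, code y = code x -> forall i, (i < n)%N -> A i (iter i f y)) ->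
  (covering_number R (iterated_join f U n) <= ((size codes)%:R)%:E)%E.
Proof.
move=> hcode /choice[A hA].
(* Each code taken by some point gets such a point as representative; the other codes get the
   default [x0]. *)
have ex (j : 'I_(size codes)) : exists x,
    (exists y, code y = tnth (in_tuple codes) j) -> code x = tnth (in_tuple codes) j.
  have [[y hy]|no] := pselect (exists y, code y = tnth (in_tuple codes) j).
    by exists y.
  by exists x0 => /no.
have [x hx] := choice ex.
apply: ereal_inf_lbound; exists (size codes) => //.
exists (fun j => \bigcap_(i in `I_n) (iter i f @^-1` A (x j) i)); split=> [j|y].
  by exists (A (x j)) => //; exact: (hA (x j)).1.
have /tnthP[j hj] : code y \in in_tuple codes by exact: hcode.
exists j => i ni; apply: (hA (x j)).2 => //.
by rewrite hx -?hj //; exists y.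
Qed.

Lemma size_flatten_le {R : numDomainType} (T : Type) (B : R) (ss : seq (seq T)) :
  all (fun s => (size s)%:R <= B) ss -> (size (flatten ss))%:R <= (size ss)%:R * B.
Proof.
elim: ss => [|s ss IH] /=; first by rewrite mul0r.
by move=> /andP[sB /IH ?]; rewrite size_cat natrD -natr1 mulrDl mul1r addrC lerD.
Qed.

(* A point of [Z] seen on [-M, M]: the distance [n] from [- M] of a position
   separating the two directions, the states [a], [b] on either side of it, and
   the words read from there to the left and to the right. *)
Definition window_codes (N M : nat) :
    seq ((nat * (nat * nat)) * (seq bool * seq bool)) :=
  flatten [seq [seq (nab, uv) | uv <- [seq (u, v) | u <- words N nab.1 nab.2.1,
                                          v <- words N (M.*2.-1 - nab.1) nab.2.2]]
    | nab <- [seq (n, ab) | n <- iota 0 M.*2,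
                            ab <- [seq (a, b) | a <- iota 0 N.+1, b <- iota 0 N.+1]]].

(** Wherever the separating position lies, the two word lengths add up to [M.*2.-1], so each triple
    of position and states allows at most [rho ^+ N * rho ^+ N * rho ^+ M.*2] pairs of words. *)
Lemma size_window_codes {R : realFieldType} (rho : R) (N M : nat) :
  1 < rho -> rho ^+ N.+1 = rho ^+ N + 1 ->
  (size (window_codes N M))%:R <=
    (M.*2 * (N.+1 * N.+1))%:R * (rho ^+ N * rho ^+ N * rho ^+ M.*2).
Proof.
move=> rho1 hrho.
rewrite -[(M.*2 * (N.+1 * N.+1))%N](_ : size [seq (n, ab) | n <- iota 0 M.*2,
  ab <- [seq (a, b) | a <- iota 0 N.+1, b <- iota 0 N.+1]] = _); last first.
  by rewrite !size_allpairs !size_iota.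
rewrite -[X in X%:R * _](size_map (fun nab : nat * (nat * nat) => [seq (nab, uv) |
  uv <- [seq (u, v) | u <- words N nab.1 nab.2.1,
                      v <- words N (M.*2.-1 - nab.1) nab.2.2]])).
apply: size_flatten_le; apply/allP => _ /mapP[[? [a b]] + ->].
move=> /allpairsP[[n ?] [/= + _ [-> _]]]; rewrite mem_iota add0n => /= nM.
rewrite size_map size_allpairs /= natrM.
have le n1 a1 : (size (words N n1 a1))%:R <= rho ^+ N * rho ^+ n1.
  apply: le_trans (size_words_le rho N n1 a1 rho1 hrho) _.
  by rewrite ler_wpM2r ?perron_weight_le // exprn_ge0; lra.
apply: (@le_trans _ _ ((rho ^+ N * rho ^+ n) * (rho ^+ N * rho ^+ (M.*2.-1 - n)))).
  by apply: ler_pM => //; exact: le.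
have rho0 : 0 < rho by lra.
rewrite mulrACA ler_wpM2l ?mulr_ge0 ?exprn_ge0 ?(ltW rho0) //.
rewrite -exprD ler_weXn2l ?(ltW rho1) //; lia.
Qed.

(** The left path runs from [n - M] down to [- M], the right one from [n - M + 1] up to [M];
    together they visit each cell of [[-M, M]] once. *)
Definition splits_at (e r M n : nat) (x : config e r) : Prop :=
  [/\ (n < M.*2)%N,
    forall i : nat, (i < n)%N ->
      transition (x (n%:Z - M%:Z - i%:Z)) (x (n%:Z - M%:Z - i.+1%:Z)) &
    forall i : nat, (i < M.*2.-1 - n)%N ->
      transition (x (n%:Z - M%:Z + 1 + i%:Z)) (x (n%:Z - M%:Z + 1 + i.+1%:Z))].

Lemma pulse_collision_splits (e r M : nat) (x : config e r) :
  (0 < M)%N -> pulse_collision x -> exists n, splits_at e r M n x.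
Proof.
move=> M0.
have build n : (n < M.*2)%N ->
    (forall k, - M%:Z < k -> k <= n%:Z - M%:Z -> transition (x k) (x (k - 1))) ->
    (forall k, n%:Z - M%:Z < k -> k < M%:Z -> transition (x k) (x (k + 1))) ->
    exists n, splits_at e r M n x.
  move=> nM tR tL; exists n; split=> // i hi.
    rewrite (_ : n%:Z - M%:Z - i.+1%:Z = n%:Z - M%:Z - i%:Z - 1); last by lia.
    by apply: tR; lia.
  rewrite (_ : n%:Z - M%:Z + 1 + i.+1%:Z = n%:Z - M%:Z + 1 + i%:Z + 1); last by lia.
  by apply: tL; lia.
move=> /pulse_collisionE[xR|[xL|[q [xR xL _]]]].
(* If there is no collision inside the window, one path is reduced to a single cell: [M] for
   [n = M.*2.-1], and [- M] for [n = 0]. *)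
- by apply: (build M.*2.-1) => [|k _ _|k h1 h2]; [lia|exact: xR|lia].
- by apply: (build 0%N) => [|k h1 h2|k _ _]; [lia|lia|exact: xL].
have [qM|Mq] := leP (- M%:Z) q; last first.
  by apply: (build 0%N) => [|k h1 h2|k h1 h2]; [lia|lia|apply: xL; lia].
have [qM'|Mq] := ltP q M%:Z.
  apply: (build `|(q + M%:Z)%R|%N) => [|k h1 h2|k h1 h2];
    [lia|apply: xR; lia|apply: xL; lia].
by apply: (build M.*2.-1) => [|k h1 h2|k h1 h2]; [lia|apply: xR; lia|lia].
Qed.

Definition window_code (e r M n : nat) (x : config e r) :
    (nat * (nat * nat)) * (seq bool * seq bool) :=
  ((n, (state x (n%:Z - M%:Z), state x (n%:Z - M%:Z + 1))),
   (path_bits _ (fun i : nat => (x (n%:Z - M%:Z - i%:Z) : cell e r)) n,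
    path_bits _ (fun i : nat => (x (n%:Z - M%:Z + 1 + i%:Z) : cell e r))
      (M.*2.-1 - n))).

Lemma mem_window_codes (e r M n : nat) (x : config e r) :
  splits_at e r M n x -> window_code e r M n x \in window_codes (e + r) M.
Proof.
move=> [nM tR tL]; apply/flattenP; eexists.
  apply/mapP; exists (n, (state x (n%:Z - M%:Z), state x (n%:Z - M%:Z + 1))) => //.
  apply/allpairsP; exists (n, (state x (n%:Z - M%:Z), state x (n%:Z - M%:Z + 1))).
  split=> //; first by rewrite mem_iota.
  apply/allpairsP; exists (state x (n%:Z - M%:Z), state x (n%:Z - M%:Z + 1)).
  by split=> //; rewrite mem_iota add0n ltnS state_le.
apply/mapP; eexists; last reflexivity.
apply/allpairsP; eexists (_, _); split; last reflexivity.
  by apply: path_bits_words => //=; rewrite subr0.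
by apply: path_bits_words => //=; rewrite addr0.
Qed.

Lemma window_code_inj (e r M n n' : nat) (x y : config e r) :
  splits_at e r M n x -> splits_at e r M n' y ->
  window_code e r M n x = window_code e r M n' y -> cylinder e r M x y.
Proof.
move=> [nM tR tL] sy E; case: (E) => nn' _ _ _ _; subst n'.
case: sy => [_ tR' tL']; case: E => s1 s2 b1 b2.
have hl := path_bits_inj _ _ _ _ _ tR tR' _ b1.
have hr := path_bits_inj _ _ _ _ _ tL tL' _ b2.
move=> k kM; have [kn|nk] := leP k (n%:Z - M%:Z).
  rewrite (_ : k = n%:Z - M%:Z - `|(n%:Z - M%:Z - k)%R|%N%:Z); last by lia.
  rewrite hl //; last by lia.
  by apply: val_inj; rewrite !subr0.
rewrite (_ : k = n%:Z - M%:Z + 1 + `|(k - (n%:Z - M%:Z + 1))%R|%N%:Z); last by lia.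
rewrite hr //; last by lia.
by apply: val_inj; rewrite !addr0.
Qed.

Lemma entropy_upper_bound {R : realType} (e r : nat) (rho : R)
    (e_gt0 : (0 < e)%N) (r_gt0 : (0 < r)%N) :
  1 < rho -> rho ^+ (e + r).+1 = rho ^+ (e + r) + 1 ->
  (topological_entropy R (restriction (@GH e r) (@pulse_collision e r)
    (pulse_collision_invariant e_gt0 r_gt0)) <= (2 * ln rho)%:E)%E.
Proof.
move=> rho1 hrho; apply: ge_ereal_sup => _ [U cU <-].
have [m hm] := pulse_collision_lebesgue e r U cU.
set Z := set_type (@pulse_collision e r) in U cU hm *.
set f := restriction _ _ _; set N := (e + r)%N in hrho *.
have iterf n (x : Z) : set_val (iter n f x) = iter n (@GH e r) (set_val x).
  by elim: n => //= n <-.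
apply/lee_addgt0Pr => eps eps0; pose d := eps / 2.
have d0 : 0 < d by rewrite divr_gt0.
have rho0 : 0 < rho by lra.
pose K : R := (N.+1 * N.+1)%:R * (rho ^+ N * rho ^+ N).
have K0 : 0 < K by rewrite !mulr_gt0 ?exprn_gt0 ?ltr0n.
(* [K] collects the pairs of boundary states and the two Perron weights; [c] collects what does not
   grow with [n] in the estimate for the window of radius [m + n]. *)
pose a := ln rho; pose c := 2 * (m%:R * (d + a)) - ln d + ln K.
rewrite -EFinD (_ : 2 * ln rho + eps = 2 * a + 2 * d); last first.
  by rewrite [2 * d]mulrC divfK.
rewrite -(limn_esup_affine_inv _ c); apply: limn_esup_le => n n0.
pose M := (m + n)%N; have M0 : (0 < M)%N by rewrite addn_gt0 n0 orbT.
have ex (x : Z) : exists n, splits_at e r M n (set_val x).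
  by apply: pulse_collision_splits => //; exact: set_valP.
have [g hg] := choice ex.
have x0 : Z.
  apply: (exist _ (fun=> ord0)); apply: mem_set; left => i; exact: isT.
have hcov : (covering_number R (iterated_join f U n) <=
    ((size (window_codes N M))%:R)%:E)%E.
  apply: (@covering_number_le _ _ _ _ _ _ _
    (fun x : Z => window_code e r M (g x) (set_val x)) x0).
    by move=> x; exact: mem_window_codes.
  move=> x; have /choice[A hA] : forall i, exists A, U A /\ forall y : Z,
      cylinder e r m (set_val (iter i f x)) (set_val y) -> A y.
    by move=> i; have [A UA hA] := hm (iter i f x); exists A.
  exists A; split=> [i|y xy i ni]; first exact: (hA i).1.
  (* Each step of [GH] costs one cell on either side, so agreement on [[-m-n, m+n]] leaves agreement
     on [[-m, m]] at all times below [n]. *)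
  apply: (hA i).2; rewrite !iterf; apply: cylinder_iter_GH => k ki.
  apply: (window_code_inj _ _ _ _ _ _ _ (hg x) (hg y) (esym xy)).
  by rewrite /M; lia.
have nR : 0 < n%:R :> R by rewrite ltr0n.
have codes0 : (0 < size (window_codes N M))%N.
  by case: (window_codes N M) (mem_window_codes _ _ _ _ _ (hg x0)).
apply: (@le_trans _ _ ((n%:R^-1)%:E * lne ((size (window_codes N M))%:R)%:E)%E).
  apply: lee_wpmul2l; first by rewrite lee_fin invr_ge0.
  rewrite lee_lne ?in_itv /= ?leey ?andbT //.
  by apply: le_ereal_inf_tmp => _ [k _ <-]; rewrite lee_fin.
rewrite lne_EFin ?ltr0n // -EFinM lee_fin mulrC ler_pdivrMr // mulrDl mulfVK ?gt_eqF //.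
have hsize : ln (size (window_codes N M))%:R <= ln (M.*2%:R * (K * rho ^+ M.*2)).
  rewrite ler_ln ?posrE ?mulr_gt0 ?exprn_gt0 ?ltr0n ?double_gt0 //.
  apply: le_trans (size_window_codes rho N M rho1 hrho) _.
  by rewrite natrM /K !mulrA.
apply: le_trans hsize _.
rewrite lnM ?posrE ?mulr_gt0 ?exprn_gt0 ?ltr0n ?double_gt0 //.
rewrite lnM ?posrE ?exprn_gt0 // lnXn // -/a -[a *+ _]mulr_natr.
(* [ln (2 M) <= 2 d M - ln d], as [ln x < x]. *)
have := ln_sublinear (mulr_gt0 d0 (_ : 0 < M.*2%:R)).
move=> /(_ ltac:(by rewrite ltr0n double_gt0)).
rewrite lnM ?posrE ?ltr0n ?double_gt0 // /c.
have -> : M.*2%:R = 2 * (m%:R + n%:R) :> R.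
  by rewrite -mul2n natrM /M natrD.
by lra.
Qed.

Theorem proposition3p1 (R : realType) (e r : nat)
    (e_gt0 : (0 < e)%N) (r_gt0 : (0 < r)%N) :
  exists rho : R,
    [/\ is_largest_eigenvalue (transition_mx R e r) rho,
        (0 < rho /\
         forall x : R, 0 < x ->
           (root ('X^(e + r + 1) - 'X^(e + r) - 1) x <-> x = rho)),
        topological_entropy R
          (restriction (@GH e r) (@pulse_collision e r)
            (pulse_collision_invariant e_gt0 r_gt0)) =
          (2 * ln rho)%:E &
        ((2 * ln rho)%:E <= topological_entropy R (@GH e r))%E].
Proof.
have [rho rho1 hrho] := perron_root_exists R (e + r).
have rho0 : 0 < rho by lra.
exists rho; split.
- by apply: transition_largest_eigenvalue => //; rewrite addn_gt0 e_gt0.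
- split=> // x x0; rewrite addn1 rootE !hornerE; split=> [/eqP h|->].
    by apply: (perron_root_unique (e + r)) => //; lra.
  by rewrite hrho; apply/eqP; lra.
- apply/eqP; rewrite eq_le entropy_upper_bound //=.
  apply: (entropy_lower_bound e r rho _ _ set_val) => //.
    exact: initial_continuous.
  by move=> x Zx; exists (exist _ x (mem_set Zx)).
- apply: (entropy_lower_bound e r rho _ _ id) => //.
    by move=> y; exact: cvg_id.
  by move=> x _; exists x.
Qed.
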